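(* Let $R,K\in(0,\infty)$ with $R>K$ and $\alpha\in(0,1]$. Let $\mathcal{F}(R,\alpha,K)$ be the class of all pairs $(\mathbf{X},P)$ where $\mathbf{X}$ is a state space and $P$ is a Borel Markov kernel on $\mathbf{X}$ with invariant probability measure $\Pi_P$ such that, for some Borel function $V:\mathbf{X}\to[0,\infty)$ and some Borel probability measure $\nu$ on $\mathbf{X}$, $$\sup_{x\in\mathbf{X}} PV(x)\le K,\qquad \inf_{\{x\in\mathbf{X}:V(x)\le R\}} P(x,\cdot)\ge\alpha\,\nu(\cdot).$$ Then for all integers $t\ge0$, $$\sup_{(\mathbf{X},P)\in\mathcal{F}(R,\alpha,K)}\ \sup_{x\in\mathbf{X}}\left\|P^t(x,\cdot)-\Pi_P\right\|_{\mathrm{TV}} = \rho_t(1-K/R,\alpha);$$ that is, $\rho_t(1-K/R,\alpha)$ is the smallest $u\ge0$ such that $\sup_{(\mathbf{X},P)\in\mathcal{F}(R,\alpha,K)}\sup_{x\in\mathbf{X}}\|P^t(x,\cdot)-\Pi_P\|_{\mathrm{TV}}\le u$. Moreover, the convergence rate $\lambda_+(1-K/R,\alpha)$ is optimal in the sense that $$\sup_{(\mathbf{X},P)\in\mathcal{F}(R,\alpha,K)}\ \lim_{t\to\infty}\left(\sup_{x\in\mathbf{X}}\left\|P^t(x,\cdot)-\Pi_P\right\|_{\mathrm{TV}}\right)^{1/t} = \lambda_+(1-K/R,\alpha).$$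
   Context: For $\gamma\in(0,1)$ and $\alpha\in(0,1]$ define (with $\wedge,\vee$ the minimum and maximum) $$\lambda_{\pm}(\gamma,\alpha) = \frac{1-\gamma\wedge\alpha \pm \sqrt{(1-\gamma\wedge\alpha)^2 + 4(\gamma\wedge\alpha)(1-\alpha\vee\gamma)}}{2},$$ and for integers $t\ge0$ (with $0^0=1$) $$\rho_t(\gamma,\alpha) = \frac{(1-\lambda_-(\gamma,\alpha))\,\lambda_+(\gamma,\alpha)^t - (1-\lambda_+(\gamma,\alpha))\,\lambda_-(\gamma,\alpha)^t}{\lambda_+(\gamma,\alpha)-\lambda_-(\gamma,\alpha)}.$$ State spaces are Borel measurable spaces. $PV(x)=\int V(y)\,P(x,dy)$; $P^t$ is the $t$-step kernel, $P^0$ the identity kernel. The condition $\inf_{\{x:V(x)\le R\}}P(x,\cdot)\ge\alpha\nu(\cdot)$ means $P(x,B)\ge\alpha\nu(B)$ for all Borel $B$ and all $x$ with $V(x)\le R$. Total variation is normalized as $\|P^t(x,\cdot)-\Pi\|_{\mathrm{TV}} = \sup_{f:\mathbf{X}\to[0,1]\text{ Borel}} \left|P^t f(x) - \int f\,d\Pi\right|$. The function $V$ and measure $\nu$ may depend on the pair $(\mathbf{X},P)$. *)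

(* Defs.v *)
From HB Require Import structures.
From mathcomp Require Import all_boot all_order all_algebra.
From mathcomp Require Import all_classical all_reals all_analysis.

Set Implicit Arguments.
Unset Strict Implicit.
Unset Printing Implicit Defensive.

Import Order.TTheory GRing.Theory Num.Theory.
Import numFieldNormedType.Exports.

Local Open Scope classical_set_scope.
Local Open Scope ring_scope.
Local Open Scope ereal_scope.

Section Rates.
Context {F : realType}.
Implicit Types gamma alpha : F.
Local Open Scope ring_scope.

Definition disc gamma alpha : F :=
  (1 - Num.min gamma alpha) ^+ 2
  + 4 * Num.min gamma alpha * (1 - Num.max alpha gamma).

Definition lambda_plus gamma alpha : F :=
  (1 - Num.min gamma alpha + Num.sqrt (disc gamma alpha)) / 2.

Definition lambda_minus gamma alpha : F :=
  (1 - Num.min gamma alpha - Num.sqrt (disc gamma alpha)) / 2.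

Definition rho (t : nat) gamma alpha : F :=
  ((1 - lambda_minus gamma alpha) * lambda_plus gamma alpha ^+ t
   - (1 - lambda_plus gamma alpha) * lambda_minus gamma alpha ^+ t)
  / (lambda_plus gamma alpha - lambda_minus gamma alpha).

End Rates.

Notation borel_space T := (g_sigma_algebraType (@open T)).

Section Kernels.
Context d (X : measurableType d) {F : realType}.

(* Typed as a subprobability kernel because the library only equips the
   composition of kernels with that structure; every iterate of a probability
   kernel does have total mass 1. *)
Fixpoint kernel_pow (P : F.-pker X ~> X) (t : nat) : F.-spker X ~> X :=
  if t is t'.+1 then mkcomp_noparam P (kernel_pow P t')
  else kdirac (@measurable_id _ X setT).

Definition invariant_measure (P : F.-pker X ~> X) (Pi : probability X F) :=
  forall B, measurable B -> \int[Pi]_x P x B = Pi B.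

Definition tv_dist (mu nu : {measure set X -> \bar F}) : \bar F :=
  ereal_sup [set `|\int[mu]_x (f x)%:E - \int[nu]_x (f x)%:E| | f in
    [set f : X -> F | measurable_fun [set: X] f
                      /\ forall x, (0 <= f x <= 1)%R]].

Definition drift_and_minorization (R K alpha : F) (P : F.-pker X ~> X) :=
  exists (V : X -> F) (nu : probability X F),
    [/\ measurable_fun [set: X] V,
        forall x, (0 <= V x)%R,
        ereal_sup [set \int[P x]_y (V y)%:E | x in [set: X]] <= K%:E
      & forall x, (V x <= R)%R ->
          forall B, measurable B -> alpha%:E * nu B <= P x B].

End Kernels.

(* The data (X, P, Pi_P).  For the kernels satisfying the drift and minorization
   conditions Pi_P is unique, so suprema over such triples are suprema over the
   pairs (X, P). *)
Record chain (F : realType) := Chain {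
  chain_top : ptopologicalType ;
  chain_kernel : F.-pker (borel_space chain_top) ~> (borel_space chain_top) ;
  chain_inv : probability (borel_space chain_top) F ;
  chain_invP : invariant_measure chain_kernel chain_inv }.

Section ChainClass.
Context {F : realType}.

(* A plain predicate rather than a [set (chain F)]: chain F lives in a universe
   above the one allowed by [set]. *)
Definition chain_class (R K alpha : F) (C : chain F) : Prop :=
  drift_and_minorization R K alpha (chain_kernel C).

Definition chain_tv (C : chain F) (t : nat) : \bar F :=
  ereal_sup [set tv_dist (kernel_pow (chain_kernel C) t x) (chain_inv C)
            | x in [set: borel_space (chain_top C)]].

Definition class_tv (R K alpha : F) (t : nat) : \bar F :=
  ereal_sup [set u | exists2 C, chain_class R K alpha C & chain_tv C t = u].

(* The value at t = 0 is irrelevant to the limit. *)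
Definition chain_root (C : chain F) (t : nat) : \bar F :=
  poweR (chain_tv C t) (t%:R^-1)%R.

Definition class_rate (R K alpha : F) : \bar F :=
  ereal_sup [set u | exists2 C, chain_class R K alpha C
                                & limn (chain_root C) = u].

End ChainClass.

(* Main.v *)
From HB Require Import structures.
Require Import Defs.
From mathcomp Require Import all_boot all_order all_algebra.
From mathcomp Require Import all_classical all_reals all_analysis.
From mathcomp Require Import measurable_realfun kernel ring lra.

Set Implicit Arguments.
Unset Strict Implicit.
Unset Printing Implicit Defensive.

Import Order.TTheory GRing.Theory Num.Theory.
Import numFieldNormedType.Exports.

Local Open Scope classical_set_scope.
Local Open Scope ring_scope.

(** Write [g = 1 - K / R].  Markov's inequality turns the drift condition into:
    from every state, the small set [{V <= R}] is entered in one step with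
    probability at least [g].

    Upper bound.  Consider [P^t f] for a test function [f] with values in [0, 1],
    its oscillation over the whole space and its oscillation over the small set.
    Both start at 1.  One more step averages [P^t f]; since every one-step law
    puts mass at least [g] on the small set, the global oscillation [a_t]
    satisfies [a_(t+1) <= g b_t + (1 - g) a_t], where [b_t] is the oscillation on
    the small set.  Two laws started in the small set share the part
    [alpha nu], which cancels in the difference; what is left has mass
    [1 - alpha], and a mass at least [max alpha g - alpha] of it sits in the
    small set, so that
    [b_(t+1) <= (max alpha g - alpha) b_t + (1 - max alpha g) a_t].  This is
    [kmean_oscillation].  Eliminating [b] from the recursion with equalities
    gives a two-term linear recursion whose characteristic roots are
    [lambda_plus] and [lambda_minus], hence [a_t = rho t] ([rho_surv_far]).  An
    invariant law averages [P^t f], so the distance from [P^t(x, .)] to it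
    is at most the oscillation of [P^t f].

    Sharpness.  The recursion is exactly the one satisfied by the probabilities
    of not having been absorbed in a three-state chain: an absorbing state, a
    small state absorbed with probability [alpha], and a large state returning
    to the small one with probability [g'] ([extremal_kernel]).  Its
    invariant law sits at the absorbing state, so the distance to it equals the
    survival probability.  The large state needs [V > R] and [(1 - g') V <= K],
    which is possible precisely when [g' > g]; the values at [g] are reached in
    the limit [g' -> g] by continuity in [g'] ([le_right_limit]).

    Rate.  With [d(t)] the worst-case distance, [d(s + t) <= 2 d(s) d(t)]
    ([chain_dist_submul]), so Fekete's argument gives the existence of the limit
    of [d(t)^(1/t)] for every chain ([cvg_root_submul]).  The survival
    probability lies between [lambda_plus ^ t] and a constant multiple of it
    ([surv_far_geometric]), which bounds all these limits by [lambda_plus] and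
    bounds those of the extremal chains from below. *)

(** * The survival recursion and its characteristic roots *)

Section Survival.
Context {F : realType}.
Implicit Types g a : F.

(** The pair ([far], [near]) of no-absorption probabilities after [t] steps of
    the three-state chain, started from the large and from the small state. *)
Fixpoint survival g a (t : nat) : F * F :=
  if t is s.+1 then
    (g * (survival g a s).2 + (1 - g) * (survival g a s).1,
     (Num.max a g - a) * (survival g a s).2
     + (1 - Num.max a g) * (survival g a s).1)
  else (1, 1).

Definition surv_far g a t := (survival g a t).1.
Definition surv_near g a t := (survival g a t).2.

Lemma surv_farS g a t :
  surv_far g a t.+1 = g * surv_near g a t + (1 - g) * surv_far g a t.
Proof. by []. Qed.

Lemma surv_nearS g a t : surv_near g a t.+1 =
  (Num.max a g - a) * surv_near g a t + (1 - Num.max a g) * surv_far g a t.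
Proof. by []. Qed.

Lemma survival_ge0 g a t : 0 <= g <= 1 -> a <= 1 ->
  0 <= surv_far g a t /\ 0 <= surv_near g a t.
Proof.
move=> /andP[g0 g1] a1; have aM : a <= Num.max a g by rewrite le_max lexx.
have M1 : Num.max a g <= 1 by rewrite ge_max a1.
elim: t => [|t [IHf IHn]]; first by split; exact: ler01.
by rewrite surv_farS surv_nearS; split; apply: addr_ge0; apply: mulr_ge0 => //;
  rewrite subr_ge0.
Qed.

(** Elimination of [surv_near]; the coefficients are symmetric in [g] and [a],
    which is why only [min] and [max] occur in the rate. *)
Lemma surv_far_rec g a t : surv_far g a t.+2 =
  (1 - Num.min g a) * surv_far g a t.+1
  + Num.min g a * (1 - Num.max a g) * surv_far g a t.
Proof.
rewrite (surv_farS _ _ t.+1) surv_nearS.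
move: (surv_near g a t) (surv_farS g a t) => n ->.
by rewrite maxC; case: (leP g a) => _; ring.
Qed.

(** The characteristic equation of [surv_far_rec]. *)
Lemma lambda_roots g a (l := lambda_plus g a) (l' := lambda_minus g a) :
    0 <= g <= 1 -> 0 <= a <= 1 ->
  l ^+ 2 = (1 - Num.min g a) * l + Num.min g a * (1 - Num.max a g) /\
  l' ^+ 2 = (1 - Num.min g a) * l' + Num.min g a * (1 - Num.max a g).
Proof.
move=> /andP[g0 g1] /andP[a0 a1].
have d0 : 0 <= disc g a.
  rewrite /disc addr_ge0 ?sqr_ge0// mulr_ge0// ?subr_ge0 ?ge_max ?a1//.
  by rewrite mulr_ge0// le_min g0.
rewrite {}/l {}/l' /lambda_plus /lambda_minus.
have := sqr_sqrtr d0; set s := Num.sqrt _; rewrite /disc => sE.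
by split; apply: (mulfI (_ : 4 != 0)); rewrite ?pnatr_eq0//; field: sE.
Qed.

Lemma lambda_plus_bounds g a : 0 <= g < 1 -> 0 <= a <= 1 ->
  [/\ 0 < lambda_plus g a, lambda_plus g a <= 1 &
      lambda_minus g a < lambda_plus g a].
Proof.
move=> /andP[g0 g1] /andP[a0 a1].
have m1 : Num.min g a < 1 by rewrite gt_min g1.
have m0 : 0 <= Num.min g a by rewrite le_min g0.
have M1 : 0 <= 1 - Num.max a g by rewrite subr_ge0 ge_max a1 ltW.
have mM : Num.min g a <= Num.max a g by rewrite ge_min le_max lexx orbT.
have d0 : 0 < disc g a.
  rewrite /disc ltr_pwDl ?exprn_gt0 ?subr_gt0//.
  by rewrite !mulr_ge0.
have := d0; rewrite -sqrtr_gt0 => s0.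
have := sqr_sqrtr (ltW d0).
rewrite /lambda_plus /lambda_minus; split; [lra| |lra].
rewrite ler_pdivrMr// mul1r -lerBrDl.
rewrite -(@ler_sqr _ _ _) ?nnegrE ?(ltW s0)//; last lra.
rewrite sqr_sqrtr ?(ltW d0)// /disc; nra.
Qed.

Lemma two_step_ind (P : nat -> Prop) : P 0%N -> P 1%N ->
  (forall t, P t -> P t.+1 -> P t.+2) -> forall t, P t.
Proof.
move=> P0 P1 PS t; suff: P t /\ P t.+1 by case.
by elim: t => [|t [? ?]]; split=> //; exact: PS.
Qed.

Lemma surv_far0 g a : surv_far g a 0 = 1. Proof. by []. Qed.

Lemma surv_far1 g a : surv_far g a 1 = 1.
Proof. by rewrite surv_farS surv_far0 /surv_near/=; ring. Qed.

Lemma rho_surv_far g a t : 0 <= g < 1 -> 0 <= a <= 1 ->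
  rho t g a = surv_far g a t.
Proof.
move=> g01 a01; have [l0 l1 ll] := lambda_plus_bounds g01 a01.
have [|E E'] := @lambda_roots g a _ a01; first by case/andP: g01 => -> /ltW ->.
have ll0 : lambda_plus g a - lambda_minus g a != 0 by rewrite subr_eq0 gt_eqF.
move: t; apply: two_step_ind => [||t].
- by rewrite /rho surv_far0 !expr0; field.
- by rewrite /rho surv_far1 !expr1; field.
rewrite surv_far_rec => <- <-; rewrite /rho.
rewrite -(addn2 t) !exprD E E' !(exprSr _ t).
set m := Num.min _ _; set M := Num.max _ _.
by field.
Qed.

(** Powers of [lambda_plus] satisfy the same recursion as [surv_far], with
    nonnegative coefficients, so comparing the values at times 0 and 1 is enough:
    there [surv_far] is 1, which lies between 1 and [lambda_plus^-1] at time 0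
    and between [lambda_plus] and 1 at time 1. *)
Lemma surv_far_geometric g a t : 0 <= g < 1 -> 0 <= a <= 1 ->
  lambda_plus g a ^+ t <= surv_far g a t
    <= (lambda_plus g a)^-1 * lambda_plus g a ^+ t.
Proof.
move=> g01 a01; have [l0 l1 _] := lambda_plus_bounds g01 a01.
have [|E _] := @lambda_roots g a _ a01; first by case/andP: g01 => -> /ltW ->.
move: t; apply: two_step_ind => [||t /andP[lt tl] /andP[lS Sl]].
- by rewrite surv_far0 expr0 lexx mulr1 invf_ge1.
- by rewrite surv_far1 expr1 l1 mulVf ?lexx ?gt_eqF.
have m1 : 0 <= 1 - Num.min g a.
  by rewrite subr_ge0 ge_min; case/andP: g01 => _ /ltW ->.
have m0 : 0 <= Num.min g a * (1 - Num.max a g).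
  case/andP: g01 a01 => g0 /ltW g1 /andP[a0 a1].
  by rewrite mulr_ge0// ?le_min ?g0// subr_ge0 ge_max a1.
have lE : lambda_plus g a ^+ t.+2 =
    (1 - Num.min g a) * lambda_plus g a ^+ t.+1 +
    Num.min g a * (1 - Num.max a g) * lambda_plus g a ^+ t.
  by rewrite -(addn2 t) exprD E exprSr; ring.
rewrite surv_far_rec lE; apply/andP; split; first by rewrite lerD// ler_wpM2l.
by rewrite [leRHS]mulrDr !(mulrCA _^-1) lerD// ler_wpM2l.
Qed.

Let continuous_maxr a : continuous (fun g => Num.max a g).
Proof.
move=> g; apply: (@continuous_max F F^o (cst a) id g); first exact: cvg_cst.
exact: cvg_id.
Qed.

Lemma continuous_surv_far a t : continuous (fun g => surv_far g a t).
Proof.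
suff: continuous (fun g => surv_far g a t) /\
      continuous (fun g => surv_near g a t) by case.
have cM := @continuous_maxr a.
elim: t => [|t [cf cn]]; first by split=> g; exact: cvg_cst.
split=> g.
  apply: cvgD; first by apply: cvgM; [exact: cvg_id|exact: cn].
  apply: cvgM; last exact: cf.
  by apply: cvgB; [exact: cvg_cst|exact: cvg_id].
apply: cvgD; apply: cvgM; [|exact: cn| |exact: cf].
  by apply: cvgB; [exact: cM|exact: cvg_cst].
by apply: cvgB; [exact: cvg_cst|exact: cM].
Qed.

Lemma continuous_lambda_plus a : continuous (fun g => lambda_plus g a).
Proof.
have cM := @continuous_maxr a.
have cm : continuous (fun g => Num.min g a).
  move=> g; apply: (@continuous_min F F^o id (cst a) g); first exact: cvg_id.
  exact: cvg_cst.
have c1m : continuous (fun g => 1 - Num.min g a).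
  by move=> g; apply: cvgB; [exact: cvg_cst|exact: cm].
have cd : continuous (fun g => disc g a).
  move=> g; apply: cvgD; first by apply: cvgM; exact: c1m.
  apply: cvgM; first by apply: cvgM; [exact: cvg_cst|exact: cm].
  by apply: cvgB; [exact: cvg_cst|exact: cM].
move=> g; apply: cvgM; last exact: cvg_cst.
apply: cvgD; first exact: c1m.
exact: (continuous_comp (cd g) (@sqrt_continuous F _)).
Qed.
End Survival.

(** * Limits of n-th roots *)

Section Roots.
Context {F : realType}.
Implicit Types (u : nat -> F) (p q l C c : F).

Definition root_seq u (n : nat) : F := u n `^ n%:R^-1.

Lemma root_seq_le u q n : (0 < n)%N -> 0 <= u n -> 0 <= q ->
  u n <= q ^+ n -> root_seq u n <= q.
Proof.
move=> n0 u0 q0 uq; rewrite -[leRHS](powRr1 q0).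
have -> : 1 = n%:R * n%:R^-1 :> F by rewrite mulfV// pnatr_eq0 -lt0n.
by rewrite powRrM powR_mulrn// ge0_ler_powR ?nnegrE ?exprn_ge0// invr_ge0.
Qed.

Lemma root_seq_ge u q n : (0 < n)%N -> 0 <= q ->
  q ^+ n <= u n -> q <= root_seq u n.
Proof.
move=> n0 q0 qu; rewrite -[leLHS](powRr1 q0).
have -> : 1 = n%:R * n%:R^-1 :> F by rewrite mulfV// pnatr_eq0 -lt0n.
rewrite powRrM powR_mulrn// ge0_ler_powR ?nnegrE ?exprn_ge0 ?invr_ge0//.
by rewrite (le_trans _ qu)// exprn_ge0.
Qed.

(** Multiplicative constants do not affect limits of [n]-th roots; in this form
    the fact is used without taking roots of [C]. *)
Lemma geometric_eventually_le C p q : 0 <= p < q ->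
  \forall n \near \oo, C * p ^+ n <= q ^+ n.
Proof.
move=> /andP[p0 pq]; have q0 := le_lt_trans p0 pq.
have pq1 : `|p / q| < 1.
  by rewrite ger0_norm ?ltr_pdivrMr ?mul1r// divr_ge0// ltW.
have := @cvg_geometric F C _ pq1.
move=> /(cvgr_le 0)/(_ 1 ltr01); apply: filterS => n.
by rewrite /geometric/= expr_div_n mulrA ler_pdivrMr ?exprn_gt0// mul1r.
Qed.

Lemma cvg_root_le u C l r : (forall n, 0 <= u n) -> 0 <= l ->
  (forall n, u n <= C * l ^+ n) -> root_seq u @ \oo --> r -> r <= l.
Proof.
move=> u0 l0 ul ur; apply/ler_addgt0Pr => e e0.
rewrite -(cvg_lim _ ur)//; apply: limr_le; first exact: cvgP ur.
near=> n; apply: root_seq_le => //; first by near: n; exact: nbhs_infty_gt.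
  by rewrite addr_ge0// ltW.
apply: le_trans (ul n) _; near: n.
by apply: geometric_eventually_le; rewrite l0 ltrDl.
Unshelve. all: by end_near. Qed.

Lemma cvg_root_ge u l r : 0 <= l ->
  (forall n, l ^+ n <= u n) -> root_seq u @ \oo --> r -> l <= r.
Proof.
move=> l0 ul ur.
rewrite -(cvg_lim _ ur)//; apply: limr_ge; first exact: cvgP ur.
near=> n; apply: root_seq_ge => //; near: n; exact: nbhs_infty_gt.
Unshelve. all: by end_near. Qed.

Section Fekete.
Variables (u : nat -> F) (c : F).
Hypothesis u0 : forall n, 0 <= u n.
Hypothesis c0 : 0 < c.
Hypothesis uM : forall m n, u (m + n)%N <= c * u m * u n.

(** A single good value of [u] bounds the whole sequence: beyond [m], peel off
    blocks of length [m], each of which costs a factor [q ^+ m]. *)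
Lemma submul_le_geometric q m : 0 < q -> (0 < m)%N -> c * u m <= q ^+ m ->
  exists C, forall n, u n <= C * q ^+ n.
Proof.
move=> q0 m0 cum; exists (\sum_(i < m) u i / q ^+ i).
elim/ltn_ind => n IH.
have [nm|mn] := ltnP n m.
  rewrite -ler_pdivrMr ?exprn_gt0//.
  rewrite (bigD1 (Ordinal nm))//= lerDl sumr_ge0// => i _.
  by rewrite divr_ge0// exprn_ge0// ltW.
rewrite -(subnKC mn); apply: le_trans (uM _ _) _.
rewrite exprD mulrCA; apply: ler_pM => //; first by rewrite mulr_ge0// ltW.
by apply: IH; rewrite ltn_subrL m0 (leq_trans m0).
Qed.

(** Fekete's lemma for nonnegative, possibly vanishing, sequences.  The limit is
    the infimum of [(c u_n)^(1/n)], described without roots as the infimum of the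
    [q] with [c u_n <= q ^+ n] for some positive [n]. *)
Lemma cvg_root_submul : cvgn (root_seq u).
Proof.
pose S := [set q : F | 0 <= q /\ exists2 n, (0 < n)%N & c * u n <= q ^+ n].
have cu n : 0 <= c * u n by rewrite mulr_ge0// ltW.
have S0 : S !=set0.
  exists (c * u 1%N); split => //; exists 1%N => //.
have lS : lbound S 0 by move=> q [].
have hS : has_inf S by split => //; exists 0.
pose L := inf S.
have L0 : 0 <= L by exact: lb_le_inf.
have upper q : L < q -> \forall n \near \oo, root_seq u n <= q.
  move=> Lq; have [p [p0 [m m0 cum]] pq] := inf_lt S0 Lq.
  (* p itself may be 0, and a positive base is needed *)
  pose p' := (p + q) / 2.
  have p'0 : 0 < p' by rewrite /p'; lra.
  have [|C uC] := @submul_le_geometric p' m p'0 m0.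
    apply: le_trans cum _; apply: lerXn2r; rewrite ?nnegrE//;
      rewrite /p'; lra.
  near=> n; apply: root_seq_le => //.
    by near: n; exact: nbhs_infty_gt.
    by rewrite (le_trans p0)// ltW.
  apply: le_trans (uC n) _; near: n.
  by apply: geometric_eventually_le; rewrite ltW//= /p'; lra.
have lower q : q < L -> \forall n \near \oo, q <= root_seq u n.
  move=> qL; have [q0|q0] := ltP q 0.
    by near=> n; apply: le_trans (ltW q0) _; exact: powR_ge0.
  pose p := (q + L) / 2; have p0 : 0 <= p by rewrite /p; lra.
  near=> n.
  have n0 : (0 < n)%N by near: n; exact: nbhs_infty_gt.
  apply: root_seq_ge => //.
  have : p ^+ n <= c * u n.
    rewrite leNgt; apply/negP => /ltW cup.
    have : L <= p by apply: ge_inf; [exists 0|split => //; exists n].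
    by rewrite /p; lra.
  rewrite -ler_pdivrMl//; apply: le_trans.
  rewrite ler_pdivlMl//; near: n.
  by apply: geometric_eventually_le; rewrite q0/= /p; lra.
apply/cvg_ex; exists L; apply/cvgrPdist_le => e e0.
have Le : L < L + e by rewrite ltrDl.
have eL : L - e < L by rewrite ltrBlDr ltrDl.
near=> n; rewrite ler_distlC; apply/andP; split; near: n.
  exact: lower.
exact: upper.
Unshelve. all: by end_near. Qed.

End Fekete.
End Roots.

(** * Means of bounded functions under minorized measures *)

Section Means.
Context d (X : measurableType d) {F : realType}.
Implicit Types (mu nu : {measure set X -> \bar F}) (f g : X -> F) (C : set X).

Definition test_function f :=
  measurable_fun [set: X] f /\ forall x, 0 <= f x <= 1.

Definition bounded_measurable f :=
  measurable_fun [set: X] f /\ exists M, forall x, `|f x| <= M.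

Lemma test_bounded f : test_function f -> bounded_measurable f.
Proof.
by case=> mf f01; split=> //; exists 1 => x; have /andP[f0 f1] := f01 x;
  rewrite ger0_norm.
Qed.

Lemma test_indic C : measurable C -> test_function (\1_C).
Proof.
move=> mC; split; first exact: measurable_indic.
by move=> x; rewrite indicE; case: (x \in C); rewrite ?lexx ler01.
Qed.

Lemma bounded_integrable mu f : mu [set: X] = 1%E -> bounded_measurable f ->
  mu.-integrable [set: X] (EFin \o f).
Proof.
move=> mu1 [mf [M fM]]; apply: measurable_bounded_integrable => //.
  by rewrite mu1 ltry.
exists M; split; first exact: num_real.
by move=> N MN x _ /=; apply: le_trans (ltW MN).
Qed.

Lemma EFin_Rintegral mu f : mu [set: X] = 1%E -> bounded_measurable f ->
  (\int[mu]_x (f x)%:E)%E = (\int[mu]_x f x)%:E.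
Proof.
by move=> mu1 bf; rewrite fineK//; apply: integrable_fin_num => //;
  exact: bounded_integrable.
Qed.

Lemma Rintegral_affine mu f a b : mu [set: X] = 1%E -> bounded_measurable f ->
  \int[mu]_x (a * f x + b) = a * \int[mu]_x f x + b.
Proof.
move=> mu1 bf; have intf := bounded_integrable mu1 bf.
rewrite RintegralD//; last 2 first.
- have -> : EFin \o (fun x => a * f x) = (fun x => a%:E * (EFin \o f) x)%E.
    by apply/funext => x /=; rewrite EFinM.
  exact: integrableZl.
- by apply: bounded_integrable => //; split=> //; exists `|b|.
by rewrite RintegralZl// Rintegral_cst//= mu1 mulr1.
Qed.

Lemma Rintegral_bounds mu f l u : mu [set: X] = 1%E -> bounded_measurable f ->
  (forall x, l <= f x <= u) -> l <= \int[mu]_x f x <= u.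
Proof.
move=> mu1 bf flu; have intf := bounded_integrable mu1 bf.
have mean_cst r : \int[mu]_x r = r by rewrite Rintegral_cst//= mu1 mulr1.
have icst (r : F) : mu.-integrable [set: X] (EFin \o cst r).
  by apply: bounded_integrable => //; split=> //; exists `|r|.
apply/andP; split; [rewrite -(mean_cst l)|rewrite -(mean_cst u)];
  apply: le_Rintegral => //; try exact: icst.
- by move=> x _; have /andP[] := flu x.
- by move=> x _; have /andP[] := flu x.
Qed.

Lemma Rintegral_sub_indic mu g C u w : mu [set: X] = 1%E -> measurable C ->
  bounded_measurable g ->
  \int[mu]_x (u - g x - w * \1_C x) = u - \int[mu]_x g x - w * fine (mu C).
Proof.
move=> mu1 mC bg.
have bC := test_bounded (test_indic mC).
have bB : bounded_measurable (fun x => -1 * g x + u).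
  split.
    by apply: measurable_funD => //; apply: measurable_funM => //; case: bg.
  have [_ [M gM]] := bg; exists (M + `|u|) => x.
  by rewrite (le_trans (ler_normD _ _))// mulN1r normrN lerD2r.
have bwC : bounded_measurable (fun x => - w * \1_C x + 0).
  split.
    by apply: measurable_funD => //; apply: measurable_funM => //; case: bC.
  have [_ [M gM]] := bC; exists (`|w| * M) => x.
  by rewrite addr0 normrM normrN ler_wpM2l.
transitivity (\int[mu]_x ((-1 * g x + u) + (- w * \1_C x + 0))).
  by apply: eq_Rintegral => x _; ring.
rewrite RintegralD//; [|exact: bounded_integrable..].
rewrite !Rintegral_affine//.
by rewrite /Rintegral integral_indic// setIT; ring.
Qed.

(** The effect of one step on an upper bound.  The function
    [(u - g) - (u - u') 1_C] is nonnegative, so its [mu]-mean is at least [a]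
    times its [nu]-mean; expanding both sides gives the inequality.  With [a = 0]
    only the mass of [C] is exploited. *)
Lemma minorized_mean_le mu nu (a u u' : F) g C :
    mu [set: X] = 1%E -> nu [set: X] = 1%E -> 0 <= a ->
    (forall B, measurable B -> (a%:E * nu B <= mu B)%E) ->
    measurable C -> bounded_measurable g ->
    (forall x, g x <= u) -> (forall x, C x -> g x <= u') -> u' <= u ->
  \int[mu]_x g x <= a * \int[nu]_x g x + (1 - a) * u
                    - (u - u') * (fine (mu C) - a * fine (nu C)).
Proof.
move=> mu1 nu1 a0 numu mC bg gu gu' u'u.
pose h x := u - g x - (u - u') * \1_C x.
have h0 x : 0 <= h x.
  rewrite /h indicE; have [/set_mem/gu'|_] := boolP (x \in C); last first.
    by rewrite mulr0 subr0 subr_ge0.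
  by rewrite mulr1; lra.
have mh : measurable_fun [set: X] h.
  apply: measurable_funB; last first.
    by apply: measurable_funM => //; exact: measurable_indic.
  by apply: measurable_funB => //; case: bg.
have bh : bounded_measurable h.
  split=> //; have [_ [M gM]] := bg; exists (`|u| + M + `|u - u'|) => x.
  rewrite /h (le_trans (ler_normB _ _))// lerD//.
    by rewrite (le_trans (ler_normB _ _))// lerD2l.
  have [_ /(_ x)/andP[i0 i1]] := test_indic mC.
  by rewrite normrM ler_piMr// ger0_norm.
have mhE : measurable_fun [set: X] (EFin \o h) by exact/measurable_EFinP.
have h0E x : (0 <= (EFin \o h) x)%E by rewrite lee_fin.
have := @ge0_le_measure_integral _ _ _ (mscale (NngNum a0) nu) mu numu
  (EFin \o h) setT measurableT h0E mhE.
rewrite (ge0_integral_mscale _ _ _ mhE)//.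
rewrite !EFin_Rintegral// -EFinM lee_fin /= !Rintegral_sub_indic//.
by lra.
Qed.

(** The mirror image of [minorized_mean_le], obtained by applying it to the
    opposite function. *)
Lemma minorized_mean_ge mu nu (a l l' : F) g C :
    mu [set: X] = 1%E -> nu [set: X] = 1%E -> 0 <= a ->
    (forall B, measurable B -> (a%:E * nu B <= mu B)%E) ->
    measurable C -> bounded_measurable g ->
    (forall x, l <= g x) -> (forall x, C x -> l' <= g x) -> l <= l' ->
  a * \int[nu]_x g x + (1 - a) * l + (l' - l) * (fine (mu C) - a * fine (nu C))
  <= \int[mu]_x g x.
Proof.
move=> mu1 nu1 a0 numu mC bg gl gl' ll'.
pose g' x := -1 * g x + 0.
have bg' : bounded_measurable g'.
  have [mg [M gM]] := bg; split.
    by apply: measurable_funD => //; exact: measurable_funM.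
  by exists M => x; rewrite /g' addr0 mulN1r normrN.
have := minorized_mean_le (u := - l) (u' := - l') mu1 nu1 a0 numu mC bg'.
rewrite !Rintegral_affine// /g' => H.
suff : -1 * (\int[mu]_x g x) + 0 <= a * (-1 * (\int[nu]_x g x) + 0) +
    (1 - a) * - l - (- l - - l') * (fine (mu C) - a * fine (nu C)) by lra.
apply: H; [by move=> x; have := gl x; lra|by move=> x /gl'; lra|by lra].
Qed.

End Means.
(** * Action of the iterated kernel on test functions *)

Section KernelComposition.
Context d (X : measurableType d) {F : realType}.

(** Integrating against a mixture.  The measure [m] is only required to agree with
    the composition on measurable sets, so that this covers both the iterates of a
    kernel and an invariant measure (with [l] a constant kernel). *)
Lemma integral_comp_kernel (l : F.-pker X ~> X) (k : F.-spker X ~> X)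
    (m : {measure set X -> \bar F}) (f : X -> \bar F) x :
    (forall B, measurable B -> m B = \int[l x]_y k y B)%E ->
    (forall y, (0 <= f y)%E) -> measurable_fun [set: X] f ->
  (\int[m]_y f y = \int[l x]_y \int[k y]_z f z)%E.
Proof.
move=> mE f0 mf.
rewrite -(@integral_kcomp _ _ _ X X X F l (kernel.kernel_snd k) x f f0 mf).
by apply: eq_measure_integral => B mB _; rewrite mE.
Qed.

End KernelComposition.

Section KernelPowers.
Context d (X : measurableType d) {F : realType}.
Variable P : F.-pker X ~> X.
Implicit Types f : X -> F.

Definition kmean t f x := \int[kernel_pow P t x]_y f y.

Lemma kernel_powT t x : kernel_pow P t x [set: X] = 1%E.
Proof.
elim: t x => [|t IH] x; first exact: prob_kernel.
rewrite /=/mkcomp_noparam/= /kcomp_noparam.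
under eq_integral do rewrite IH.
by rewrite integral_cst// mul1e prob_kernel.
Qed.

Lemma kmean_test t f : test_function f -> test_function (kmean t f).
Proof.
move=> [mf f01]; have bf : bounded_measurable f by apply: test_bounded.
split; last first.
  by move=> x; apply: Rintegral_bounds => //; exact: kernel_powT.
apply/measurable_EFinP.
rewrite (_ : EFin \o _ = fun x => (\int[kernel_pow P t x]_y (f y)%:E)%E).
  apply: measurable_fun_integral_kernel.
  - by move=> U mU; exact: measurable_kernel.
  - by move=> z; rewrite lee_fin; have /andP[] := f01 z.
  - exact/measurable_EFinP.
by apply/funext => x; rewrite EFin_Rintegral//; exact: kernel_powT.
Qed.

Lemma kmean0 f x : test_function f -> kmean 0 f x = f x.
Proof.
move=> tf; rewrite /kmean /Rintegral/= /kdirac integral_dirac//.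
  by rewrite diracT mul1e.
by apply/measurable_EFinP; case: tf.
Qed.

Lemma kmeanS t f x : test_function f ->
  kmean t.+1 f x = \int[P x]_y kmean t f y.
Proof.
move=> tf; apply: EFin_inj; rewrite /kmean.
have bf := test_bounded tf; have bk := test_bounded (kmean_test t tf).
rewrite -!EFin_Rintegral//; [|exact: prob_kernel|exact: kernel_powT].
rewrite (@integral_comp_kernel _ _ _ P (kernel_pow P t) _ _ x)//.
- by apply: eq_integral => y _; rewrite EFin_Rintegral//; exact: kernel_powT.
- by move=> y; rewrite lee_fin; have [_ /(_ y)/andP[]] := tf.
- by apply/measurable_EFinP; case: tf.
Qed.

Lemma kmeanD s t f x : test_function f ->
  kmean (s + t) f x = kmean s (kmean t f) x.
Proof.
move=> tf; elim: s x => [|s IH] x; first by rewrite kmean0//; exact: kmean_test.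
rewrite addSn !kmeanS//; last exact: kmean_test.
by apply: eq_Rintegral => y _; rewrite IH.
Qed.

Lemma kmean_invariant (Pi : probability X F) t f : invariant_measure P Pi ->
  test_function f -> \int[Pi]_x kmean t f x = \int[Pi]_x f x.
Proof.
move=> invP tf; elim: t => [|t IH].
  by apply: eq_Rintegral => x _; rewrite kmean0.
rewrite -IH; have tg := kmean_test t tf; have bg := test_bounded tg.
have bPg := test_bounded (kmean_test t.+1 tf).
have Pi1 : Pi [set: X] = 1%E := probability_setT Pi.
apply: EFin_inj; rewrite -!EFin_Rintegral//.
have mPi : measurable_fun [set: X] (fun _ : X => (Pi : pprobability X F)) by [].
rewrite [RHS](@integral_comp_kernel _ _ _ (kprobability mPi) P Pi _ point)//.
- apply: eq_integral => x _; rewrite kmeanS// EFin_Rintegral//.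
  exact: prob_kernel.
- by move=> B mB; exact/esym/invP.
- by move=> y; rewrite lee_fin; have [_ /(_ y)/andP[]] := tg.
- by apply/measurable_EFinP; case: tg.
Qed.
End KernelPowers.

(** * Contraction of oscillations under drift and minorization *)

Section Drift.
Context d (X : measurableType d) {F : realType}.
Variables (P : F.-pker X ~> X) (R K alpha : F) (V : X -> F).
Variable nu : probability X F.
Hypothesis R0 : 0 < R.
Hypothesis K0 : 0 <= K.
Hypothesis KR : K <= R.
Hypothesis alpha01 : 0 <= alpha <= 1.
Hypothesis mV : measurable_fun [set: X] V.
Hypothesis V0 : forall x, 0 <= V x.
Hypothesis drift :
  (ereal_sup [set \int[P x]_y (V y)%:E | x in [set: X]] <= K%:E)%E.
Hypothesis minor : forall x, V x <= R ->
  forall B, measurable B -> (alpha%:E * nu B <= P x B)%E.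

Let C := [set x | V x <= R].
Let g := 1 - K / R.

Let mC : measurable C.
Proof.
rewrite (_ : C = [set: X] `&` V @^-1` `]-oo, R]); first exact: mV.
by rewrite setTI; apply/seteqP; split=> x /=; rewrite in_itv.
Qed.

(** Markov's inequality, in the form [R (1 - 1_C) <= V]. *)
Lemma sublevel_prob x : g <= fine (P x C).
Proof.
have P1 : P x [set: X] = 1%E by exact: prob_kernel.
have tC := test_indic (F := F) mC; have bC := test_bounded tC.
have : ((\int[P x]_y (- R * \1_C y + R))%:E <= K%:E)%E.
  have bA : bounded_measurable (fun y => - R * \1_C y + R).
    split.
      by apply: measurable_funD => //; apply: measurable_funM => //; case: tC.
    have [_ [M CM]] := bC; exists (`|R| * M + `|R|) => y.
    by rewrite (le_trans (ler_normD _ _))// lerD2r normrM normrN ler_wpM2l.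
  apply: le_trans drift.
  apply: (@le_trans _ _ (\int[P x]_y (V y)%:E)%E); last first.
    by apply: ereal_sup_ubound; exists x.
  rewrite -EFin_Rintegral//; apply: ge0_le_integral => //.
  - move=> y _; rewrite lee_fin; have [_ /(_ y)/andP[i0 i1]] := tC.
    by rewrite mulNr addrC subr_ge0 ler_piMr// ltW.
  - by apply/measurable_EFinP; case: bA.
  - exact/measurable_EFinP.
  - move=> y _; rewrite lee_fin indicE.
    have [_|/negP yC] := boolP (y \in C); first by rewrite mulr1 addNr.
    have : R < V y by rewrite ltNge; apply/negP => yR; apply: yC; rewrite inE.
    by rewrite mulr0 add0r => /ltW.
rewrite Rintegral_affine// lee_fin /Rintegral integral_indic// setIT => H.
rewrite /g lerBlDr -lerBlDl ler_pdivlMr//.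
by lra.
Qed.

(** The oscillation estimate.  Global bounds and bounds on the small set are
    carried together because one step mixes the two oscillations; the ordering
    [l <= l'] and [u' <= u] makes the weight [u - u'] of the small set
    nonnegative in [minorized_mean_le]. *)
Lemma kmean_oscillation t f : test_function f -> exists l u l' u',
  [/\ forall x, l <= kmean P t f x <= u,
      forall x, C x -> l' <= kmean P t f x <= u',
      l <= l' /\ u' <= u,
      u - l <= surv_far g alpha t & u' - l' <= surv_near g alpha t].
Proof.
have g01 : 0 <= g <= 1.
  rewrite /g; apply/andP; split.
    by rewrite subr_ge0 ler_pdivrMr// mul1r.
  by rewrite gerBl divr_ge0// ltW.
case/andP: (g01) => g0 g1; case/andP: alpha01 => a0 a1.
move=> tf; elim: t => [|t [l [u [l' [u' [lu lu' [ll' uu'] farE nearE]]]]]].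
  exists 0, 1, 0, 1; rewrite subr0; split=> // x; rewrite ?kmean0//.
    by have [_] := tf.
  by move=> _; have [_] := tf.
set h := kmean P t f in lu lu'.
have bh : bounded_measurable h by exact/test_bounded/kmean_test.
set n := \int[nu]_x h x.
set M := Num.max alpha g.
have aM : alpha <= M by rewrite le_max lexx.
have M1 : M <= 1 by rewrite ge_max a1.
have nu1 : nu [set: X] = 1%E := probability_setT nu.
pose U1 := u - (u - u') * g; pose L1 := l + (l' - l) * g.
pose U2 := alpha * n + (1 - alpha) * u - (u - u') * (M - alpha).
pose L2 := alpha * n + (1 - alpha) * l + (l' - l) * (M - alpha).
have bnd1 x : L1 <= kmean P t.+1 f x <= U1.
  rewrite kmeanS//; have P1 : P x [set: X] = 1%E by exact: prob_kernel.
  have pC := sublevel_prob x.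
  have P0 B : measurable B -> (0%:E * P x B <= P x B)%E by rewrite mul0e.
  apply/andP; split.
    apply: le_trans (@minorized_mean_ge _ _ _ (P x) (P x) 0 l l' h C
      P1 P1 (lexx _) P0 mC bh _ _ ll').
    - by rewrite /L1 !mul0r subr0 subr0 add0r mul1r lerD2l ler_wpM2l// subr_ge0.
    - by move=> y; have /andP[] := lu y.
    - by move=> y /lu'/andP[].
  apply: le_trans (@minorized_mean_le _ _ _ (P x) (P x) 0 u u' h C
      P1 P1 (lexx _) P0 mC bh _ _ uu') _.
  - by move=> y; have /andP[] := lu y.
  - by move=> y /lu'/andP[].
  - rewrite /U1 !mul0r subr0 subr0 add0r mul1r lerD2l lerN2 ler_wpM2l//.
    by rewrite subr_ge0.
have bnd2 x : C x -> L2 <= kmean P t.+1 f x <= U2.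
  move=> Cx; rewrite kmeanS//; have P1 : P x [set: X] = 1%E by exact: prob_kernel.
  have pC := sublevel_prob x.
  (* the minorization on C if g <= alpha, and nu C <= 1 otherwise *)
  have res : M - alpha <= fine (P x C) - alpha * fine (nu C).
    have nC1 : fine (nu C) <= 1.
      by rewrite -lee_fin fineK ?probability_le1// fin_num_measure.
    have : alpha * fine (nu C) <= fine (P x C).
      rewrite -lee_fin EFinM !fineK ?minor ?fin_num_measure//.
      exact: finite_kernel_measure.
    rewrite /M; case: (leP alpha g) => _; nra.
  apply/andP; split.
    apply: le_trans (@minorized_mean_ge _ _ _ (P x) nu alpha l l' h C
      P1 nu1 a0 (minor Cx) mC bh _ _ ll').
    - by rewrite /L2 lerD2l ler_wpM2l// subr_ge0.
    - by move=> y; have /andP[] := lu y.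
    - by move=> y /lu'/andP[].
  apply: le_trans (@minorized_mean_le _ _ _ (P x) nu alpha u u' h C
      P1 nu1 a0 (minor Cx) mC bh _ _ uu') _.
  - by move=> y; have /andP[] := lu y.
  - by move=> y /lu'/andP[].
  - by rewrite /U2 lerD2l lerN2 ler_wpM2l// subr_ge0.
(* L2 and U2 need not lie in [L1, U1]; truncating restores the ordering
   without enlarging the gap *)
exists L1, U1, (Num.max L1 L2), (Num.min U1 U2); split.
- exact: bnd1.
- move=> x Cx; have /andP[l1 u1] := bnd1 x; have /andP[l2 u2] := bnd2 x Cx.
  by rewrite ge_max l1 l2 le_min u1 u2.
- by rewrite le_max lexx ge_min lexx.
- rewrite surv_farS /U1 /L1; nra.
- apply: (@le_trans _ _ (U2 - L2)).
    by apply: lerB; rewrite ?ge_min ?le_max lexx orbT.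
  rewrite surv_nearS -/M /U2 /L2; nra.
Qed.

Lemma kmean_invariant_le (Pi : probability X F) t f x :
  invariant_measure P Pi -> test_function f ->
  `|kmean P t f x - \int[Pi]_y f y| <= surv_far g alpha t.
Proof.
move=> invP tf; have [l [u [_ [_ [lu _ _ farE _]]]]] := kmean_oscillation t tf.
rewrite -(kmean_invariant t invP tf).
have Pi1 : Pi [set: X] = 1%E := probability_setT Pi.
have /andP[lP Pu] := Rintegral_bounds Pi1 (test_bounded (kmean_test P t tf)) lu.
have /andP[lx xu] := lu x.
by apply: le_trans farE; rewrite ler_norml; lra.
Qed.

End Drift.

(** * The extremal three-state chain *)

Section ThreePointMeasure.
Context d (T : measurableType d) {F : realType}.
Variables (p q r : {nonneg F}) (x y z : T).

Definition three_point : {measure set T -> \bar F} :=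
  measure_add (mscale p \d_x) (measure_add (mscale q \d_y) (mscale r \d_z)).

Lemma three_pointE (U : set T) : three_point U =
  (p%:num * \1_U x + q%:num * \1_U y + r%:num * \1_U z)%:E.
Proof.
apply: etrans (measure_addE _ _ U) _.
by rewrite [X in (_ + X)%E](measure_addE _ _ U); exact: addeA.
Qed.

Lemma integral_three_point (f : T -> F) : measurable_fun [set: T] f ->
  (forall t, 0 <= f t) -> (\int[three_point]_t (f t)%:E)%E =
  (p%:num * f x + q%:num * f y + r%:num * f z)%:E.
Proof.
move=> mf f0; have mfE : measurable_fun [set: T] (EFin \o f).
  exact/measurable_EFinP.
have f0E s : (0 <= (EFin \o f) s)%E by rewrite lee_fin.
have iE (k : {nonneg F}) (s : T) :
    (\int[mscale k \d_s]_t (EFin \o f) t = (k%:num * f s)%:E)%E.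
  rewrite (ge0_integral_mscale _ _ _ mfE)//.
  rewrite EFinM; congr (_ * _)%E.
  by apply: etrans (integral_dirac _ _ mfE) _ => //; rewrite diracT mul1e.
apply: etrans (ge0_integral_measure_add _ _ _ _ mfE) _ => //.
rewrite [X in (_ + X)%E](ge0_integral_measure_add _ _ _ _ mfE)// !iE.
exact: addeA.
Qed.
End ThreePointMeasure.

Section Extremal.
Context {F : realType}.
Variables (g alpha : F).
Hypothesis g01 : 0 <= g <= 1.
Hypothesis alpha01 : 0 <= alpha <= 1.

Local Notation X := (borel_space nat).
Let M := Num.max alpha g.

Lemma measurable_borel_nat (A : set X) : measurable A.
Proof. by apply: sub_sigma_algebra; exact: discrete_open. Qed.

Lemma measurable_fun_borel_nat d (Y : measurableType d) (f : X -> Y) :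
  measurable_fun [set: X] f.
Proof. by move=> _ B _; exact: measurable_borel_nat. Qed.

(** The state space is [nat], discrete: 0 is absorbing, 1 is the small state, and
    every other number behaves as the large state 2. *)
Definition to_absorbed (x : nat) : F :=
  match x with 0%N => 1 | 1%N => alpha | _ => 0 end.
Definition to_small (x : nat) : F :=
  match x with 0%N => 0 | 1%N => M - alpha | _ => g end.
Definition to_large (x : nat) : F :=
  match x with 0%N => 0 | 1%N => 1 - M | _ => 1 - g end.

Lemma to_absorbed_ge0 x : 0 <= to_absorbed x.
Proof. by case: x => [|[|x]] //=; case/andP: alpha01. Qed.

Lemma to_small_ge0 x : 0 <= to_small x.
Proof.
case: x => [|[|x]] //=; last by case/andP: g01.
by rewrite subr_ge0 le_max lexx.
Qed.

Lemma to_large_ge0 x : 0 <= to_large x.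
Proof.
case/andP: alpha01 g01 => _ a1 /andP[_ g1].
by case: x => [|[|x]] //=; rewrite subr_ge0// ge_max a1.
Qed.

Definition extremal_kernel (x : X) : {measure set X -> \bar F} :=
  three_point (NngNum (to_absorbed_ge0 x)) (NngNum (to_small_ge0 x))
    (NngNum (to_large_ge0 x)) (0%N : X) (1%N : X) (2%N : X).

Lemma measurable_extremal_kernel (U : set X) : measurable U ->
  measurable_fun [set: X] (extremal_kernel ^~ U).
Proof. by move=> _; exact: measurable_fun_borel_nat. Qed.

HB.instance Definition _ := @isKernel.Build _ _ X X F extremal_kernel
  measurable_extremal_kernel.

Lemma extremal_kernelE x (U : set X) : extremal_kernel x U =
  (to_absorbed x * \1_U 0%N + to_small x * \1_U 1%N + to_large x * \1_U 2%N)%:E.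
Proof. exact: three_pointE. Qed.

Lemma extremal_kernelT x : extremal_kernel x [set: X] = 1%E.
Proof.
rewrite extremal_kernelE !indicE !in_setT !mulr1; congr EFin.
by case: x => [|[|x]] /=; ring.
Qed.

HB.instance Definition _ := @Kernel_isProbability.Build _ _ X X F extremal_kernel
  extremal_kernelT.

Lemma integral_extremal_kernel x (f : X -> F) : (forall y, 0 <= f y) ->
  (\int[extremal_kernel x]_y (f y)%:E)%E =
  (to_absorbed x * f 0%N + to_small x * f 1%N + to_large x * f 2%N)%:E.
Proof.
by move=> f0; apply: integral_three_point => //;
  exact: measurable_fun_borel_nat.
Qed.

(** First-step analysis of the chain is the recursion defining [survival]. *)
Lemma extremal_kernel_pow t x : kernel_pow extremal_kernel t x (~` [set 0%N]) =
  (match x with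
   | 0%N => 0 | 1%N => surv_near g alpha t | _ => surv_far g alpha t
   end)%:E.
Proof.
elim: t x => [|t IH] x.
  rewrite /= /kdirac/= diracE.
  case: x => [|x]; first by rewrite memNset//=; apply.
  by rewrite mem_set//; case: x.
rewrite /= /mkcomp_noparam/= /kcomp_noparam.
under eq_integral do rewrite IH.
rewrite integral_extremal_kernel/=; last first.
  have [|n0 f0] := @survival_ge0 _ g alpha t g01; first by case/andP: alpha01.
  by case=> [|[|y]].
case: x => [|[|x]] /=; congr EFin; first by ring.
  by rewrite surv_nearS -/M; ring.
by rewrite surv_farS; ring.
Qed.

Lemma extremal_invariant : invariant_measure extremal_kernel \d_(0%N : X).
Proof.
move=> B mB; rewrite integral_dirac//; last exact: measurable_fun_borel_nat.
rewrite diracT mul1e.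
by rewrite extremal_kernelE/= !mul0r !addr0 mul1r diracE indicE.
Qed.

Definition extremal_chain : chain F := Chain extremal_invariant.

End Extremal.

(** * The worst-case distance to equilibrium *)

Section ChainDistance.
Context {F : realType} (C : chain F).
Let P := chain_kernel C.
Let Pi := chain_inv C.

Definition chain_dist t := fine (chain_tv C t).

Lemma chain_tv_le t r :
    (forall f x, test_function f -> `|kmean P t f x - \int[Pi]_y f y| <= r) ->
  (chain_tv C t <= r%:E)%E.
Proof.
move=> H; apply: ge_ereal_sup => _ [x _ <-].
apply: ge_ereal_sup => _ [f tf <-].
have bf := test_bounded tf.
rewrite !EFin_Rintegral//; [|exact: probability_setT|exact: kernel_powT].
by rewrite -EFinB abse_EFin lee_fin; exact: H.
Qed.

Lemma chain_tv_ge t f x : test_function f ->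
  (`|kmean P t f x - \int[Pi]_y f y|%:E <= chain_tv C t)%E.
Proof.
move=> tf; have bf := test_bounded tf.
apply: le_trans (ereal_sup_ubound _); last by exists x.
apply: ereal_sup_ubound; exists f => //.
rewrite !EFin_Rintegral//; [exact: probability_setT|exact: kernel_powT].
Qed.

Lemma test_cst0 : test_function (cst 0 : borel_space (chain_top C) -> F).
Proof. by split=> // x /=; rewrite lexx ler01. Qed.

Lemma chain_tvE t : chain_tv C t = (chain_dist t)%:E.
Proof.
rewrite fineK// ge0_fin_numE; last first.
  by apply: le_trans (chain_tv_ge t point test_cst0); rewrite lee_fin.
apply: le_lt_trans (_ : (1%:E < +oo)%E); last exact: ltry.
apply: chain_tv_le => f x tf; have [_ f01] := tf.
have [_ /(_ x)/andP[k0 k1]] := kmean_test P t tf.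
have Pi1 : Pi [set: _] = 1%E := probability_setT Pi.
have /andP[i0 i1] := Rintegral_bounds Pi1 (test_bounded tf) f01.
by rewrite ler_norml; lra.
Qed.

Lemma chain_dist_ge t f x : test_function f ->
  `|kmean P t f x - \int[Pi]_y f y| <= chain_dist t.
Proof. by move=> tf; rewrite -lee_fin -chain_tvE chain_tv_ge. Qed.

Lemma chain_dist_le t r :
    (forall f x, test_function f -> `|kmean P t f x - \int[Pi]_y f y| <= r) ->
  chain_dist t <= r.
Proof. by move=> H; rewrite -lee_fin -chain_tvE chain_tv_le. Qed.

Lemma chain_dist_ge0 t : 0 <= chain_dist t.
Proof. by apply: le_trans (chain_dist_ge t point test_cst0). Qed.

(** The factor 2 comes from rescaling: [P^t f] minus its mean takes values in
    [[- d(t), d(t)]], so it is a test function up to a shift and a dilation by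
    [2 d(t)], and the shift does not affect the difference of two means. *)
Lemma chain_dist_submul s t :
  chain_dist (s + t) <= 2 * chain_dist s * chain_dist t.
Proof.
apply: chain_dist_le => f x tf; set m := \int[Pi]_y f y.
have tk := kmean_test P t tf; have bk := test_bounded tk.
have km y : `|kmean P t f y - m| <= chain_dist t by exact: chain_dist_ge.
have Ps : kernel_pow P s x [set: _] = 1%E by exact: kernel_powT.
rewrite kmeanD//.
have [d0|d0] := eqVneq (chain_dist t) 0.
  have kE y : kmean P t f y = m.
    by apply/eqP; rewrite -subr_eq0 -normr_le0 -d0.
  rewrite (_ : kmean P s _ x = m) ?subrr ?normr0 ?d0 ?mulr0//.
  rewrite /kmean; under eq_Rintegral do rewrite -/(kmean P t f _) kE.
  by rewrite Rintegral_cst//= Ps mulr1.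
have {}d0 : 0 < chain_dist t by rewrite lt_neqAle eq_sym d0 chain_dist_ge0.
pose a := (2 * chain_dist t)^-1; have a0 : 0 < a by rewrite invr_gt0 mulr_gt0.
pose b := (chain_dist t - m) * a.
pose h y := a * kmean P t f y + b.
have th : test_function h.
  split.
    by apply: measurable_funD => //; apply: measurable_funM => //; case: tk.
  move=> y; have := km y; rewrite ler_distl => /andP[k1 k2].
  rewrite /h /b mulrC -mulrDl mulr_ge0 ?(ltW a0)//=; last lra.
  by rewrite ler_pdivrMr ?mulr_gt0//; lra.
have Pi1 : Pi [set: _] = 1%E := probability_setT Pi.
have := chain_dist_ge s x th.
rewrite /kmean /h -/(kmean P t f) !Rintegral_affine//.
rewrite (kmean_invariant t (chain_invP (c := C)) tf) -/m -/(kmean P s _ x).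
rewrite opprD addrACA subrr addr0 -mulrBr normrM (gtr0_norm a0).
rewrite /a ler_pdivrMl ?mulr_gt0//.
by rewrite mulrAC.
Qed.

Lemma chain_rootE t : chain_root C t = (root_seq chain_dist t)%:E.
Proof. by rewrite /chain_root chain_tvE poweR_EFin. Qed.

Lemma cvg_root_dist : cvgn (root_seq chain_dist).
Proof.
by apply: (cvg_root_submul (c := 2)) chain_dist_submul; first exact: chain_dist_ge0.
Qed.

Lemma cvg_chain_root : chain_root C @ \oo --> (limn (root_seq chain_dist))%:E.
Proof.
rewrite (_ : chain_root C = EFin \o root_seq chain_dist).
  by apply: cvg_EFin => //; [exact: nearW|exact: cvg_root_dist].
by apply/funext => t; exact: chain_rootE.
Qed.

Lemma chain_class_dist_le R K alpha t : 0 < K -> K < R -> 0 < alpha <= 1 ->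
  chain_class R K alpha C -> chain_dist t <= surv_far (1 - K / R) alpha t.
Proof.
move=> K0 KR /andP[a0 a1] [V [nu [mV V0 drift minor]]].
apply: chain_dist_le => f x tf.
apply: (kmean_invariant_le (nu := nu) (V := V)) => //.
- exact: lt_trans KR.
- exact: ltW.
- exact: ltW.
- by rewrite ltW.
- exact: chain_invP.
Qed.

End ChainDistance.

(** * Sharpness and the optimal rate *)

Section ExtremalChain.
Context {F : realType}.
Variables (R K alpha g : F).
Hypothesis K0 : 0 < K.
Hypothesis KR : K < R.
Hypothesis alpha01 : 0 <= alpha <= 1.
Hypothesis g01 : 0 <= g <= 1.
Hypothesis gK : 1 - K / R < g < 1.

Let C := extremal_chain g01 alpha01.

(** [V] vanishes off the large state, where it takes the largest value
    [K / (1 - g)] that the drift condition allows; this exceeds [R] because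
    [1 - K / R < g].  The minorizing measure sits at the absorbing state. *)
Lemma extremal_in_class : chain_class R K alpha C.
Proof.
have R0 := lt_trans K0 KR; case/andP: gK => Kg g1.
have q0 : 0 < 1 - g by rewrite subr_gt0.
have /andP[a0 a1] := alpha01.
exists (fun x : nat => if (x < 2)%N then 0 else K / (1 - g)),
  \d_(0%N : borel_space nat).
split.
- exact: measurable_fun_borel_nat.
- by move=> x; case: ifP => // _; rewrite divr_ge0 ?ltW.
- apply: ge_ereal_sup => _ [x _ <-].
  rewrite (integral_extremal_kernel g01 alpha01 x); last first.
    by move=> y; case: ifP => // _; rewrite divr_ge0 ?ltW.
  rewrite /= !mulr0 !add0r lee_fin mulrCA ger_pMr// ler_pdivrMr// mul1r.
  case: x => [|[|x]] //=; first exact: ltW.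
  by rewrite lerD2l lerN2 le_max lexx orbT.
- move=> x + B _; case: ltnP => [x2 _|_]; last first.
    rewrite ler_pdivrMr// => H; exfalso; move: Kg.
    by rewrite ltrBlDr -ltrBlDl ltr_pdivlMr// mulrC ltNge H.
  apply: le_trans (_ : (alpha * \1_B 0%N)%:E <= _)%E; first exact: lexx.
  rewrite [leRHS](extremal_kernelE g01 alpha01) lee_fin.
  have i0 y : 0 <= \1_B y :> F by rewrite indicE ler0n.
  rewrite -[leLHS]addr0 -addrA lerD//; last first.
    by rewrite addr_ge0// mulr_ge0// ?to_small_ge0 ?to_large_ge0.
  by case: x x2 => [|[|x]] //= _; rewrite ler_wpM2r.
Qed.

(** The invariant law gives mass 0 to the non-absorbed states, so their indicator
    separates it from the law started at the large state by the survival
    probability. *)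
Lemma extremal_dist_ge t : surv_far g alpha t <= chain_dist C t.
Proof.
pose A : set (borel_space nat) := ~` [set 0%N].
have tA : test_function (\1_A : borel_space nat -> F).
  by apply: test_indic; exact: measurable_borel_nat.
have inv0 : fine (chain_inv C A) = 0.
  rewrite -[chain_inv C A]/((\1_A (0%N : borel_space nat))%:E) /=.
  by rewrite indicE memNset//=; apply.
apply: le_trans (@chain_dist_ge _ C t _ (2%N : borel_space nat) tA).
rewrite /kmean /Rintegral !integral_indic ?setIT//; try exact: measurable_borel_nat.
rewrite [in X in _ <= `|X - _|](extremal_kernel_pow g01 alpha01)/=.
by rewrite -[X in _ - X]/(fine (chain_inv C A)) inv0 subr0 ler_norm.
Qed.

End ExtremalChain.

(** Extremal chains exist only for parameters strictly above [1 - K / R]; this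
    transfers their lower bounds to [1 - K / R] itself. *)
Lemma le_right_limit {F : realType} (f : F -> F) (g b : F) (S : \bar F) :
  g < b -> {for g, continuous f} ->
  (forall g', g < g' < b -> ((f g')%:E <= S)%E) -> ((f g)%:E <= S)%E.
Proof.
move=> gb cf fS.
have fg : (f x)%:E @[x --> g^'+] --> (f g)%:E.
  by apply: cvg_EFin; [exact: nearW|exact: cvg_at_right_filter].
apply: cvge_le fg; near=> x; apply: fS; apply/andP; split.
  by near: x; exact: nbhs_right_gt.
by near: x; exact: nbhs_right_lt.
Unshelve. all: by end_near. Qed.

Theorem proposition3p2 (F : realType) (R K alpha : F)
    (hK : 0 < K) (hKR : K < R) (halpha0 : 0 < alpha) (halpha1 : alpha <= 1) :
  (forall t : nat,
     [/\ class_tv R K alpha t = (rho t (1 - K / R) alpha)%:E,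
         0 <= rho t (1 - K / R) alpha
       & forall u : F, 0 <= u -> (class_tv R K alpha t <= u%:E)%E ->
           rho t (1 - K / R) alpha <= u])
  /\ (forall C : chain F, chain_class R K alpha C -> cvgn (chain_root C))
  /\ class_rate R K alpha = (lambda_plus (1 - K / R) alpha)%:E.
Proof.
have R0 := lt_trans hK hKR.
set g := 1 - K / R.
have g0 : 0 <= g by rewrite subr_ge0 ler_pdivrMr// mul1r ltW.
have g1 : g < 1 by rewrite gtrBl divr_gt0.
have g01 : 0 <= g < 1 by rewrite g0.
have a01 : 0 <= alpha <= 1 by rewrite ltW.
have near_g g' : g < g' < 1 -> 0 <= g' <= 1.
  by case/andP=> gg' g'1; rewrite (le_trans g0) ltW.
have upper C t : chain_class R K alpha C -> chain_dist C t <= surv_far g alpha t.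
  by apply: chain_class_dist_le => //; rewrite halpha0.
have tvE t : class_tv R K alpha t = (surv_far g alpha t)%:E.
  apply/eqP; rewrite eq_le; apply/andP; split.
    apply: ge_ereal_sup => _ [C CC <-].
    by rewrite chain_tvE lee_fin; exact: upper.
  apply: (@le_right_limit _ (fun x => surv_far x alpha t) g 1 _ g1).
    exact: continuous_surv_far.
  move=> g' gg'; have g'01 := near_g g' gg'.
  apply: (@le_trans _ _ (chain_tv (extremal_chain g'01 a01) t)).
    by rewrite chain_tvE lee_fin extremal_dist_ge.
  apply: ereal_sup_ubound; exists (extremal_chain g'01 a01) => //.
  exact: extremal_in_class.
split; last split.
- move=> t; rewrite rho_surv_far// tvE; split=> //.
  have g01' : 0 <= g <= 1 by rewrite g0 ltW.
  by case: (survival_ge0 t g01' halpha1).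
- by move=> C _; apply/cvg_ex; eexists; exact: cvg_chain_root.
have limE C : limn (chain_root C) = (limn (root_seq (chain_dist C)))%:E.
  by apply/cvg_lim => //; exact: cvg_chain_root.
apply/eqP; rewrite eq_le; apply/andP; split.
  apply: ge_ereal_sup => _ [C CC <-]; rewrite limE lee_fin.
  have [l0 _ _] := lambda_plus_bounds g01 a01.
  apply: (cvg_root_le _ (ltW l0) _ (@cvg_root_dist _ C)).
    exact: chain_dist_ge0.
  move=> t; apply: le_trans (upper C t CC) _.
  by have /andP[_] := surv_far_geometric t g01 a01; apply: le_trans.
apply: (@le_right_limit _ (fun x => lambda_plus x alpha) g 1 _ g1).
  exact: continuous_lambda_plus.
move=> g' gg'; have g'01 := near_g g' gg'.
have g'lt : 0 <= g' < 1 by case/andP: g'01 gg' => -> _ /andP[_ ->].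
pose C := extremal_chain g'01 a01.
apply: (@le_trans _ _ (limn (chain_root C))); last first.
  by apply: ereal_sup_ubound; exists C => //; exact: extremal_in_class.
rewrite limE lee_fin; have [l0 _ _] := lambda_plus_bounds g'lt a01.
apply: (cvg_root_ge (ltW l0) _ (@cvg_root_dist _ C)) => t.
by apply: le_trans (extremal_dist_ge _ _ t); have /andP[] := surv_far_geometric t g'lt a01.
Qed.
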